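(* Let $\Omega$ be an alphabet and $\mathbb{K}$ a field of characteristic zero. Let $D_\lambda$ be a simple derivation on the algebra of moulds on $\Omega$, $(D_\lambda M)^{\underline{s}}=\lambda_{\underline{s}}M^{\underline{s}}$, and let $M^\bullet$ be a mould satisfying $$D_\lambda M^\bullet=A^\bullet\times M^\bullet,$$ where: (i) $\lambda_{\underline{s}}\neq0$ for every word $\underline{s}$ of length $l(\underline{s})\ge1$; (ii) $M^\emptyset=1$; (iii) the mould $A^\bullet$ is alternal. Then the mould $M^\bullet$ is symetral.
   Context: $\Omega^*$ is the set of words on $\Omega$, including the empty word $\emptyset$; $l$ denotes length. A mould is a map $M^\bullet:\Omega^*\to\mathbb{K}$. Product: $(M\times N)^{\underline{s}}=\sum_{\underline{s}^1\underline{s}^2=\underline{s}}M^{\underline{s}^1}N^{\underline{s}^2}$ (sum over factorizations by concatenation). Given a function $\lambda_\bullet:\Omega^*\to\mathbb{K}$, the map $D_\lambda:(D_\lambda M)^{\underline{s}}=\lambda_{\underline{s}}M^{\underline{s}}$ is a derivation of the mould algebra for $\times$ precisely when $\lambda_{\underline{s}^1\underline{s}^2}=\lambda_{\underline{s}^1}+\lambda_{\underline{s}^2}$ for all $\underline{s}^1,\underline{s}^2\in\Omega^*$; this is assumed. $\mathrm{sh}(\underline{s}^1,\underline{s}^2)$ denotes the words obtained by interleaving $\underline{s}^1$ and $\underline{s}^2$ preserving the internal order of each; sums over it run over all interleavings, with multiplicity. $M^\bullet$ is alternal if $M^\emptyset=0$ and $\sum_{\underline{s}\in\mathrm{sh}(\underline{s}^1,\underline{s}^2)}M^{\underline{s}}=0$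 for all non-empty words $\underline{s}^1,\underline{s}^2$. $M^\bullet$ is symetral if $\sum_{\underline{s}\in\mathrm{sh}(\underline{s}^1,\underline{s}^2)}M^{\underline{s}}=M^{\underline{s}^1}M^{\underline{s}^2}$ for all $\underline{s}^1,\underline{s}^2\in\Omega^*$. *)

(* Defs.v *)
From mathcomp Require Import all_boot all_algebra.

Set Implicit Arguments.
Unset Strict Implicit.
Unset Printing Implicit Defensive.

Import GRing.Theory.

(* The list of all interleavings of s and t, one entry per interleaving: a word
   obtained in k different ways occurs k times.  An interleaving of a :: s' and
   b :: t' starts either with a, taken from the first word, or with b, taken
   from the second one. *)
Fixpoint sh (T : Type) (s : seq T) : seq T -> seq (seq T) :=
  match s with
  | [::] => fun t => [:: t]
  | a :: s' =>
      fix sh_s (t : seq T) : seq (seq T) :=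
        match t with
        | [::] => [:: s]
        | b :: t' => [seq a :: u | u <- sh s' t] ++ [seq b :: u | u <- sh_s t']
        end
  end.

Lemma sh0s (T : Type) (t : seq T) : sh [::] t = [:: t].
Proof. by []. Qed.

Lemma shs0 (T : Type) (s : seq T) : sh s [::] = [:: s].
Proof. by case: s. Qed.

Lemma sh_cons (T : Type) (a b : T) (s t : seq T) :
  sh (a :: s) (b :: t) =
    [seq a :: u | u <- sh s (b :: t)] ++ [seq b :: u | u <- sh (a :: s) t].
Proof. by []. Qed.

Lemma size_sh (T : Type) (s t : seq T) :
  size (sh s t) = 'C(size s + size t, size s).
Proof.
elim: s t => [|a s IHs] t; first by rewrite bin0.
elim: t => [|b t IHt]; first by rewrite addn0 binn.
by rewrite sh_cons size_cat !size_map IHs IHt /= [in RHS]addSn binS addnC addnS.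
Qed.

Local Open Scope ring_scope.

Section Moulds.

Variables (Omega : Type) (K : fieldType).

Definition mould : Type := seq Omega -> K.

(* A factorization of s into two words is given by the length i of the first
   one, so i ranges over 0, ..., size s. *)
Definition mould_mul (M N : mould) : mould :=
  fun s => \sum_(i < (size s).+1) M (take i s) * N (drop i s).

(* Moulds are compared extensionally. *)
Definition mould_derivation (D : mould -> mould) : Prop :=
  (forall (a : K) (M N : mould),
     D (fun s => a * M s + N s) =1 (fun s => a * D M s + D N s)) /\
  (forall M N : mould,
     D (mould_mul M N) =1 (fun s => mould_mul (D M) N s + mould_mul M (D N) s)).

Definition mould_D (lambda : seq Omega -> K) (M : mould) : mould :=
  fun s => lambda s * M s.

Definition alternal (M : mould) : Prop :=
  M [::] = 0 /\
  forall s1 s2 : seq Omega, s1 <> [::] -> s2 <> [::] ->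
    \sum_(s <- sh s1 s2) M s = 0.

Definition symetral (M : mould) : Prop :=
  forall s1 s2 : seq Omega, \sum_(s <- sh s1 s2) M s = M s1 * M s2.

End Moulds.

(* Main.v *)
Require Import Defs.
From mathcomp Require Import all_boot all_algebra.

Local Open Scope ring_scope.

(** Write [S F s t] for the sum of a mould [F] over the interleavings of [s] and
    [t].  The proof compares, for non-empty [s] and [t], two ways of computing
    [S (D_lambda M) s t].

    Since [lambda] is additive ([lambda_cat]), it takes the same value
    [lambda s + lambda t] on all interleavings of [s] and [t], which gives
    [(lambda s + lambda t) * S M s t] ([shsum_lambda]).

    On the other hand [D_lambda M = A * M], and cutting an interleaving of [s]
    and [t] in two amounts to cutting [s] and [t] and interleaving the prefixes
    and the suffixes separately ([shsum_mould_mul]); dually, the shuffle product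
    is a morphism for deconcatenation.  Because [A] is alternal, only the cuts
    that leave one of the two prefixes empty survive.  By induction on the total
    length, [M] satisfies the symetrality relation on the remaining suffixes, so
    that the surviving terms add up to
    [(A * M) s * M t + M s * (A * M) t = (lambda s + lambda t) * (M s * M t)].

    The factor [lambda s + lambda t = lambda (s ++ t)] is nonzero, hence can be
    cancelled. *)

Import GRing.Theory.

Definition shsum {Omega : Type} {K : fieldType} (F : mould Omega K)
    (s t : seq Omega) : K :=
  \sum_(u <- sh s t) F u.

Section ShuffleSums.

Variables (Omega : Type) (K : fieldType).
Implicit Types (F P Q A M : mould Omega K) (s t u : seq Omega).

Lemma size_take_ord s (i : 'I_(size s).+1) : size (take i s) = i.
Proof. by apply: size_takel; rewrite -ltnS. Qed.

Lemma shsum0s F t : shsum F [::] t = F t.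
Proof. by rewrite /shsum sh0s big_seq1. Qed.

Lemma shsums0 F s : shsum F s [::] = F s.
Proof. by rewrite /shsum shs0 big_seq1. Qed.

Lemma shsum_cons F a b s t :
  shsum F (a :: s) (b :: t) =
    shsum (fun u => F (a :: u)) s (b :: t)
    + shsum (fun u => F (b :: u)) (a :: s) t.
Proof. by rewrite /shsum sh_cons big_cat !big_map. Qed.

Lemma eq_shsum F P s t : F =1 P -> shsum F s t = shsum P s t.
Proof. by move=> eqFP; apply: eq_bigr => u _; apply: eqFP. Qed.

Lemma shsumD F P s t :
  shsum (fun u => F u + P u) s t = shsum F s t + shsum P s t.
Proof. exact: big_split. Qed.

Lemma shsumZ c F s t : shsum (fun u => c * F u) s t = c * shsum F s t.
Proof. by rewrite /shsum mulr_sumr. Qed.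

Lemma mould_mul_cons P Q a u :
  mould_mul P Q (a :: u) =
    P [::] * Q (a :: u) + mould_mul (fun v => P (a :: v)) Q u.
Proof. by rewrite /mould_mul big_ord_recl. Qed.

(** The mould [P] is arbitrary, so that the induction on the words may replace
    it by its translates [P (a :: _)]. *)
Lemma shsum_mould_mul P Q s t :
  shsum (mould_mul P Q) s t =
    \sum_(i < (size s).+1) \sum_(j < (size t).+1)
       shsum P (take i s) (take j t) * shsum Q (drop i s) (drop j t).
Proof.
elim: s t P => [|a s IHs] t P.
  by rewrite big_ord1 shsum0s; apply: eq_bigr => j _; rewrite !shsum0s.
elim: t P => [|b t IHt] P.
  by rewrite shsums0; apply: eq_bigr => i _; rewrite big_ord1 /= !shsums0.
rewrite shsum_cons (eq_shsum _ _ _ _ (mould_mul_cons P Q a)).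
rewrite (eq_shsum _ _ _ _ (mould_mul_cons P Q b)) !shsumD !shsumZ.
rewrite IHs IHt addrACA -mulrDr -shsum_cons.
(* On the right, a first prefix or a second prefix that is empty contributes to
   only one of the two recursive sums; when both are non-empty, the first letter
   decides which of the two sums receives the term. *)
rewrite [in RHS]big_ord_recl [in RHS]big_ord_recl /= shsum0s -addrA.
congr (_ + _).
rewrite [X in _ + X = _]big_ord_recl addrCA /=.
congr (_ + _).
  by apply: eq_bigr => j _; rewrite !shsum0s.
rewrite -big_split; apply: eq_bigr => i _.
rewrite big_ord_recl [RHS]big_ord_recl /= !shsums0 -addrA.
congr (_ + _).
rewrite -big_split; apply: eq_bigr => j _ /=.
by rewrite shsum_cons mulrDl.
Qed.

(** Testing the Leibniz rule on the indicator of the words of length [size s]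
    and on the constant mould 1 isolates a single factorization; no equality
    test on letters is involved. *)
Lemma lambda_cat (lambda : seq Omega -> K) s t :
  mould_derivation (mould_D lambda) -> lambda (s ++ t) = lambda s + lambda t.
Proof.
case=> _ /(_ (fun u => (size u == size s)%:R) (fun=> 1) (s ++ t)).
have pick (f : nat -> K) :
    \sum_(i < (size (s ++ t)).+1) f i * (size (take i (s ++ t)) == size s)%:R
      = f (size s).
  have lt_s : (size s < (size (s ++ t)).+1)%N by rewrite ltnS size_cat leq_addr.
  rewrite (bigD1 (Ordinal lt_s)) //= take_size_cat // eqxx mulr1.
  rewrite big1 ?addr0 // => i ne_i; rewrite size_take_ord.
  by move: ne_i; rewrite -val_eqE /= => /negbTE->; rewrite mulr0.
rewrite /mould_mul /mould_D -big_split /=.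
under eq_bigr do rewrite mulr1 -[_%:R]mul1r.
rewrite (pick (fun=> 1)) mulr1 => ->.
under eq_bigr do rewrite !mulr1 [X in _ + X]mulrC -mulrDl.
rewrite (pick (fun i => lambda (take i (s ++ t)) + lambda (drop i (s ++ t)))).
by rewrite take_size_cat // drop_size_cat.
Qed.

(** An additive function only sees the letters of a word, not their order, so it
    is constant on the interleavings of two given words. *)
Lemma shsum_lambda (lambda : seq Omega -> K) F s t :
    (forall u v, lambda (u ++ v) = lambda u + lambda v) ->
  shsum (mould_D lambda F) s t = (lambda s + lambda t) * shsum F s t.
Proof.
move=> lambdaD.
have lambda_nil : lambda [::] = 0.
  by apply: (addrI (lambda [::])); rewrite -lambdaD addr0.
have lambda_cons a u : lambda (a :: u) = lambda [:: a] + lambda u.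
  by rewrite -lambdaD.
have D_cons G a : (fun u => mould_D lambda G (a :: u)) =1
    (fun u => lambda [:: a] * G (a :: u)
              + mould_D lambda (fun v => G (a :: v)) u).
  by move=> u; rewrite /mould_D lambda_cons mulrDl.
elim: s t F => [|a s IHs] t F; first by rewrite !shsum0s lambda_nil add0r.
elim: t F => [|b t IHt] F; first by rewrite !shsums0 lambda_nil addr0.
rewrite !shsum_cons !(eq_shsum _ _ _ _ (D_cons _ _)) !shsumD !shsumZ IHs IHt.
rewrite -!mulrDl mulrDr; congr (_ * _ + _ * _).
  by rewrite addrA -lambda_cons.
by rewrite addrCA -lambda_cons.
Qed.

Lemma alternal_shsum A s t :
  alternal A -> shsum A s t = (nilp t)%:R * A s + (nilp s)%:R * A t.
Proof.
case=> A0 Ash; case: s => [|a s]; case: t => [|b t].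
- by rewrite shsum0s A0 !mulr0 addr0.
- by rewrite shsum0s mul0r add0r mul1r.
- by rewrite shsums0 mul0r addr0 mul1r.
by rewrite !mul0r addr0; apply: Ash.
Qed.

End ShuffleSums.

Theorem mainTheorem7 (Omega : Type) (K : fieldType)
    (K_char0 : [pchar K] =i pred0)
    (lambda : seq Omega -> K)
    (D_derivation : mould_derivation (mould_D lambda))
    (A M : mould Omega K)
    (DM_eq : mould_D lambda M =1 mould_mul A M)
    (lambda_neq0 : forall s : seq Omega, (1 <= size s)%N -> lambda s <> 0)
    (M_empty : M [::] = 1)
    (A_alternal : alternal A) :
  symetral M.
Proof.
have lambdaD u v : lambda (u ++ v) = lambda u + lambda v by exact: lambda_cat.
have A0 : A [::] = 0 by case: A_alternal.
move=> s t; rewrite -/(shsum M s t).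
have [n] := ubnP (size s + size t); elim: n s t => // n IHn s t; rewrite ltnS => le_n.
case: (posnP (size s)) => [/size0nil->|s_gt0].
  by rewrite shsum0s M_empty mul1r.
case: (posnP (size t)) => [/size0nil->|t_gt0].
  by rewrite shsums0 M_empty mulr1.
have st_neq0 : lambda s + lambda t != 0.
  by rewrite -lambdaD; apply/eqP/lambda_neq0; rewrite size_cat addn_gt0 s_gt0.
apply: (mulfI st_neq0).
rewrite -shsum_lambda // (eq_shsum _ _ _ _ _ _ DM_eq) shsum_mould_mul.
(* The cut (0, 0) satisfies both indicators below; this does no harm, since both
   terms then contain the factor A [::] = 0. *)
have term (i : 'I_(size s).+1) (j : 'I_(size t).+1) :
    shsum A (take i s) (take j t) * shsum M (drop i s) (drop j t) =
      (j == 0 :> nat)%:R * (A (take i s) * M (drop i s) * M t)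
      + (i == 0 :> nat)%:R * (A (take j t) * M (drop j t) * M s).
  rewrite alternal_shsum // /nilp !size_take_ord.
  case: i j => [[|i] lt_i] [[|j] lt_j] /=;
    rewrite !(take0, drop0, A0, mul0r, mulr0, mul1r, add0r, addr0) //.
  - rewrite IHn; first by rewrite -mulrA (mulrC (M s)).
    by rewrite size_drop; apply: leq_trans le_n; rewrite ltn_add2l ltn_subrL.
  - rewrite IHn ?mulrA //.
    by rewrite size_drop; apply: leq_trans le_n; rewrite ltn_add2r ltn_subrL.
under eq_bigr do [under eq_bigr do rewrite term; rewrite big_split /=].
rewrite big_split /= mulrDl.
have DME u : mould_mul A M u = lambda u * M u by rewrite -DM_eq.
congr (_ + _).
  rewrite mulrA -DME mulr_suml; apply: eq_bigr => i _.
  by rewrite big_ord_recl /= mul1r big1 ?addr0 // => j _; rewrite mul0r.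
rewrite big_ord_recl /= [X in _ + X]big1 => [|i _]; last first.
  by rewrite big1 // => j _; rewrite mul0r.
rewrite addr0 [M s * _]mulrC mulrA -DME mulr_suml.
by apply: eq_bigr => j _; rewrite mul1r.
Qed.
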